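(* Let $\Gamma$ be a countable group, let $f$ be a strongly ergodic measure preserving action of $\Gamma$ on a standard Borel probability space $(X,\mu)$, and let $g$ be a measure preserving action of $\Gamma$ on a finite probability space $(Y,\nu)$ with $\nu(\{y\})>0$ for all $y\in Y$. If $f$ weakly contains $g$, then $g$ is a factor of $f$.
   Context: Actions are right actions, written $x\mapsto x\gamma$. For a measurable set $A$ and $\gamma\in\Gamma$, $A^\gamma$ denotes the image of $A$ under $\gamma$. Weak containment: an action $f$ of $\Gamma$ on $(X,\mu)$ weakly contains an action $g$ on $(Y,\nu)$ ($f\succeq g$) if for all measurable $A_1,\dots,A_n\subseteq Y$, all finite $F\subseteq\Gamma$ and all $\varepsilon>0$ there are measurable $B_1,\dots,B_n\subseteq X$ with $|\mu(B_i^\gamma\cap B_j)-\nu(A_i^\gamma\cap A_j)|<\varepsilon$ for all $1\le i,j\le n$, $\gamma\in F$. The action $g$ is a factor of $f$ if there is a $\Gamma$-equivariant measurable map $\Phi:X\to Y$ with $\Phi_*\mu=\nu$. A sequence of measurable sets $A_n\subseteq X$ is almost invariant if $\mu(A_n\setminus A_n\gamma)\to 0$ for every $\gamma\in\Gamma$, and trivial if $\mu(A_n)(1-\mu(A_n))\to0$. An action is strongly ergodic if it is ergodic and every almost invariant sequence is trivial.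
   Formalization: The factor map is required to be equivariant almost everywhere for each group element, the usual convention; everywhere-equivariance can fail, e.g. when X has a null fixed point and the action on Y has none. *)

(* Defs.v *)
From mathcomp Require Import all_boot all_order all_algebra.
From mathcomp Require Import all_classical all_reals all_analysis.
Set Implicit Arguments. Unset Strict Implicit. Unset Printing Implicit Defensive.
Import Order.TTheory GRing.Theory Num.Theory.
Import numFieldNormedType.Exports.
Local Open Scope classical_set_scope.
Local Open Scope ring_scope.

Definition gmul (G : groupType) (x y : G) : G := mathcomp.boot.monoid.mul x y.
Definition gone (G : groupType) : G := mathcomp.boot.monoid.one.

(* Polish space: a complete (pseudo)metric space which is Hausdorff
   (hence metric) and separable. *)
Definition polish_space (R : realType) (P : completePseudoMetricType R) : Prop :=
  hausdorff_space P /\ exists D : set P, countable D /\ closure D = setT.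

Definition standard_borel (R : realType) (d : measure_display)
  (X : measurableType d) : Prop :=
  exists (P : completePseudoMetricType R) (phi : X -> P),
    polish_space P /\ bijective phi /\
    forall A : set X, measurable A <-> <<s [set U : set P | open U] >> (phi @` A).

Definition right_action (G : groupType) (X : Type) (a : X -> G -> X) : Prop :=
  (forall x, a x (gone G) = x) /\
  (forall x g h, a (a x g) h = a x (gmul g h)).

Definition mp_action (R : realType) (G : groupType) (d : measure_display)
  (X : measurableType d) (mu : probability X R) (a : X -> G -> X) : Prop :=
  right_action a /\
  (forall g, measurable_fun setT (fun x => a x g)) /\
  (forall g (A : set X), measurable A -> mu ((fun x => a x g) @^-1` A) = mu A).

Definition act_img (G : groupType) (X : Type) (a : X -> G -> X) (A : set X) (g : G)
  : set X := (fun x => a x g) @` A.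

Definition ergodic (R : realType) (G : groupType) (d : measure_display)
  (X : measurableType d) (mu : probability X R) (a : X -> G -> X) : Prop :=
  forall A : set X, measurable A -> (forall g, act_img a A g = A) ->
    mu A = 0%E \/ mu A = 1%E.

Definition almost_invariant (R : realType) (G : groupType) (d : measure_display)
  (X : measurableType d) (mu : probability X R) (a : X -> G -> X)
  (A : nat -> set X) : Prop :=
  (forall n, measurable (A n)) /\
  forall g : G, (fun n => fine (mu (A n `\` act_img a (A n) g))) @ \oo --> (0 : R^o).

Definition trivial_seq (R : realType) (d : measure_display)
  (X : measurableType d) (mu : probability X R) (A : nat -> set X) : Prop :=
  (fun n => fine (mu (A n)) * (1 - fine (mu (A n)))) @ \oo --> (0 : R^o).

Definition strongly_ergodic (R : realType) (G : groupType) (d : measure_display)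
  (X : measurableType d) (mu : probability X R) (a : X -> G -> X) : Prop :=
  ergodic mu a /\
  forall A : nat -> set X, almost_invariant mu a A -> trivial_seq mu A.

Definition weakly_contains (R : realType) (G : groupType)
  (d1 d2 : measure_display) (X : measurableType d1) (Y : measurableType d2)
  (mu : probability X R) (a : X -> G -> X) (nu : probability Y R) (b : Y -> G -> Y)
  : Prop :=
  forall (n : nat) (A : 'I_n -> set Y) (F : seq G) (eps : R),
    (forall i, measurable (A i)) -> 0 < eps ->
    exists B : 'I_n -> set X, (forall i, measurable (B i)) /\
      forall (i j : 'I_n) (g : G), g \in F ->
        (`| mu (act_img a (B i) g `&` B j) - nu (act_img b (A i) g `&` A j) |
           < eps%:E)%E.

Definition is_factor (R : realType) (G : groupType)
  (d1 d2 : measure_display) (X : measurableType d1) (Y : measurableType d2)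
  (mu : probability X R) (a : X -> G -> X) (nu : probability Y R) (b : Y -> G -> Y)
  : Prop :=
  exists Phi : X -> Y,
    measurable_fun setT Phi /\
    (forall g : G, {ae mu, forall x, Phi (a x g) = b (Phi x) g}) /\
    (forall B : set Y, measurable B -> mu (Phi @^-1` B) = nu B).

(* Main.v *)
(* Applying weak containment to the points of Y gives measurable maps
   f_n : X -> Y that are asymptotically equivariant and asymptotically push mu
   to nu.  The set where f_n and f_m agree is almost invariant, so by strong
   ergodicity its measure is eventually close to 0 or to 1.  Any |Y| + 1 maps
   must agree in pairs somewhere, so the measures cannot all be close to 0:
   some f_n0 agrees with infinitely many f_n on a non-negligible set, hence
   nearly everywhere.  These f_n are then pairwise close and form a Cauchy
   sequence for the distance mu {f <> h}; its limit is the factor map. *)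
Require Import Defs.
From mathcomp Require Import all_boot all_order all_algebra.
From mathcomp Require Import all_classical all_reals all_analysis.
From mathcomp Require Import lra.
Import Order.TTheory GRing.Theory Num.Theory.
Import numFieldNormedType.Exports.
Local Open Scope classical_set_scope.
Local Open Scope ring_scope.

Set Implicit Arguments.
Unset Strict Implicit.
Unset Printing Implicit Defensive.

Lemma sum_le_size (R : realType) (I : Type) (s : seq I) (P : pred I)
    (f : I -> R) (e : R) :
  0 <= e -> (forall i, P i -> f i <= e) ->
  \sum_(i <- s | P i) f i <= (size s)%:R * e.
Proof.
move=> e0 fe; elim: s => [|i s IHs]; first by rewrite big_nil mul0r.
rewrite big_cons /= -natr1 mulrDl mul1r; case: ifP => Pi.
  by rewrite addrC lerD// fe.
by rewrite (le_trans IHs)// lerDl.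
Qed.

(** * Elementary estimates for a probability measure *)

Section FiniteMeasure.
Context {R : realType} {d : measure_display} {X : measurableType d}.
Variable mu : probability X R.

(** Values in [R] rather than in the extended reals let [lra] settle the epsilon estimates. *)
Definition pr (A : set X) : R := fine (mu A).

Lemma prK (A : set X) : measurable A -> (pr A)%:E = mu A.
Proof. by move=> mA; rewrite fineK// fin_num_measure. Qed.

Lemma pr_ge0 (A : set X) : 0 <= pr A.
Proof. exact: fine_ge0. Qed.

Lemma prT : pr setT = 1.
Proof. by rewrite /pr probability_setT. Qed.

Lemma probability_setT_nonempty : [set: X] !=set0.
Proof.
apply/set0P/eqP => X0; have := prT; rewrite X0 /pr measure0/= => /eqP.
by rewrite eq_sym oner_eq0.
Qed.

Lemma le_pr (A B : set X) :
  measurable A -> measurable B -> A `<=` B -> pr A <= pr B.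
Proof.
by move=> mA mB AB; rewrite -lee_fin !prK// le_measure// inE.
Qed.

Lemma prU (A B : set X) : measurable A -> measurable B ->
  pr (A `|` B) <= pr A + pr B.
Proof.
move=> mA mB; rewrite -lee_fin EFinD !prK//; last exact: measurableU.
exact: measureU2.
Qed.

Lemma pr_sub2 (A B C : set X) : measurable A -> measurable B -> measurable C ->
  A `<=` B `|` C -> pr A <= pr B + pr C.
Proof.
move=> mA mB mC sub; apply: le_trans (prU mB mC).
by apply: le_pr => //; exact: measurableU.
Qed.

Lemma pr_sub3 (A B C D : set X) : measurable A -> measurable B ->
  measurable C -> measurable D ->
  A `<=` B `|` C `|` D -> pr A <= pr B + pr C + pr D.
Proof.
move=> mA mB mC mD sub; apply: le_trans (pr_sub2 mA _ mD sub) _.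
  exact: measurableU.
by rewrite lerD2r; exact: prU.
Qed.

Lemma prC (A : set X) : measurable A -> pr (~` A) = 1 - pr A.
Proof.
move=> mA; apply: EFin_inj.
by rewrite EFinB !prK ?probability_setC//; exact: measurableC.
Qed.

Lemma prD (A B : set X) : measurable A -> measurable B -> A `<=` B ->
  pr A + pr (B `\` A) = pr B.
Proof.
move=> mA mB AB; have mBA : measurable (B `\` A) by exact: measurableD.
apply: EFin_inj; rewrite EFinD !prK// -measureU//.
  by rewrite setDUK.
by rewrite setDIK.
Qed.

Lemma pr_le_sum (I : eqType) (s : seq I) (P : pred I) (A : set X)
    (F : I -> set X) :
  measurable A -> (forall i, measurable (F i)) ->
  (forall x, A x -> exists i, [/\ i \in s, P i & F i x]) ->
  pr A <= \sum_(i <- s | P i) pr (F i).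
Proof.
move=> mA mF; elim: s A mA => [|i s IHs] A mA AF.
  rewrite big_nil; have -> : A = set0.
    by apply/seteqP; split => x // /AF[? []].
  by rewrite /pr measure0.
rewrite big_cons; case: ifP => Pi.
  have -> : pr A = pr (A `&` F i) + pr (A `\` (A `&` F i)).
    by rewrite prD//; exact: measurableI.
  apply: lerD; first by apply: le_pr => //; exact: measurableI.
  apply: IHs; first by apply: measurableD => //; exact: measurableI.
  move=> x [Ax nF]; have [j [+ Pj Fj]] := AF _ Ax.
  rewrite inE => /predU1P[ji|js]; last by exists j.
  by exfalso; apply: nF; split=> //; rewrite -ji.
apply: IHs => // x /AF[j [+ Pj Fj]].
rewrite inE => /predU1P[ji|js]; last by exists j.
by move: Pj; rewrite ji Pi.
Qed.

Lemma sum_le_pr (I : eqType) (s : seq I) (P : pred I) (A : set X)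
    (F : I -> set X) :
  uniq s -> measurable A -> (forall i, measurable (F i)) ->
  (forall x i j, F i x -> F j x -> i = j) ->
  (forall i, P i -> F i `<=` A) ->
  \sum_(i <- s | P i) pr (F i) <= pr A.
Proof.
move=> + mA mF dF; elim: s P A mA => [|i s IHs] P A mA /=.
  by rewrite big_nil pr_ge0.
move=> /andP[is_ us] FA; rewrite big_cons; case: ifP => Pi; last exact: IHs.
rewrite -(prD (mF i) mA (FA _ Pi)) lerD2l.
(* Adding membership in [s] to the predicate excludes [i], so the remaining sets are disjoint from
   [F i] and the induction runs inside the complement of [F i] in [A]. *)
rewrite big_seq_cond (eq_bigl (fun j => (j \in s) && ((j \in s) && P j))).
  rewrite -big_seq_cond; apply: IHs => //; first exact: measurableD.
  move=> j /andP[js Pj] x Fx; split; first exact: FA Fx.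
  by move=> Fix; move: is_; rewrite (dF _ _ _ Fix Fx) js.
by move=> j; rewrite andbA andbb.
Qed.

Lemma pr_geometric_cover (A : set X) (F : nat -> set X) (e : R) :
  0 <= e -> measurable A -> (forall i, measurable (F i)) ->
  A `<=` \bigcup_i F i -> (forall i, pr (F i) <= e / (2 ^ i.+1)%:R) ->
  pr A <= e.
Proof.
move=> e0 mA mF AF Fe; rewrite -lee_fin prK//.
apply: le_trans (measure_sigma_subadditive mu mF mA AF) _.
have := @epsilon_trick R (fun=> 0%E) e xpredT (fun=> lexx _) e0.
rewrite [X in (_ <= X + _)%E]eseries0// add0e; apply: le_trans.
apply: lee_nneseries => [i _|i _]; first by rewrite measure_ge0.
by rewrite add0e; have := Fe i; rewrite -lee_fin (prK (mF i)).
Qed.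

End FiniteMeasure.

(** * Maps into a finite set and the distance [pr mu (differ f g)] *)

Section DiscreteMaps.
Context {R : realType} {d : measure_display} {X : measurableType d}.
Context {Y : choiceType}.
Hypothesis finY : finite_set [set: Y].

Definition discrete_measurable (f : X -> Y) :=
  forall B : set Y, measurable (f @^-1` B).

(** Splitting along the finitely many values of [f] leaves intersections of two preimages, so [P]
    can be arbitrary. *)
Lemma measurable_rel (f g : X -> Y) (P : Y -> Y -> Prop) :
  discrete_measurable f -> discrete_measurable g ->
  measurable [set x | P (f x) (g x)].
Proof.
move=> mf mg; have -> : [set x | P (f x) (g x)] =
    \bigcup_(y in [set: Y]) (f @^-1` [set y] `&` g @^-1` [set z | P y z]).
  by apply/seteqP; split => [x Px|x [y _ [/= <-]]//]; exists (f x).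
by apply: fin_bigcup_measurable => // y _; exact: measurableI.
Qed.

(** Disjoint sets become fibres of one map. Points outside all of them get the default [y0], so they
    enter the preimage of [B] exactly when [y0] lies in [B]. *)
Lemma discrete_measurable_xget (y0 : Y) (Q : Y -> set X) :
  (forall y, measurable (Q y)) ->
  (forall x y z, Q y x -> Q z x -> y = z) ->
  discrete_measurable (fun x => xget y0 [set y | Q y x]).
Proof.
move=> mQ dQ B; set f := fun x => _.
have mU C : measurable (\bigcup_(y in C) Q y).
  by apply: fin_bigcup_measurable => //; exact: sub_finite_set finY.
have fQ x y : Q y x -> f x = y.
  by move=> Qyx; apply: xget_subset1 => // u v; exact: dQ.
have fN x : ~ (\bigcup_(y in setT) Q y) x -> f x = y0.
  by move=> nQ; apply: xgetPN => y Qyx; apply: nQ; exists y.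
have -> : f @^-1` B = \bigcup_(y in B) Q y `|`
    ((~` \bigcup_(y in setT) Q y) `&` [set _ | B y0]).
  apply/seteqP; split => x /=.
    move=> Bfx; have [[y _ Qyx]|nQ] := pselect ((\bigcup_(y in setT) Q y) x).
      by left; exists y => //; rewrite -(fQ _ _ Qyx).
    by right; split => //; rewrite -(fN _ nQ).
  by case=> [[y By /fQ ->]//|[/fN ->]].
apply: measurableU => //; apply: measurableI; first exact: measurableC.
have [By0|nBy0] := pselect (B y0).
  by rewrite (_ : [set _ : X | B y0] = setT)//; apply/seteqP; split.
by rewrite (_ : [set _ : X | B y0] = set0)//; apply/seteqP; split.
Qed.

Variable mu : probability X R.

Definition agree (f g : X -> Y) : set X := [set x | f x = g x].
Definition differ (f g : X -> Y) : set X := [set x | f x <> g x].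

Lemma measurable_agree (f g : X -> Y) :
  discrete_measurable f -> discrete_measurable g -> measurable (agree f g).
Proof. by move=> mf mg; exact: (measurable_rel (fun y z => y = z)). Qed.

Lemma measurable_differ (f g : X -> Y) :
  discrete_measurable f -> discrete_measurable g -> measurable (differ f g).
Proof. by move=> mf mg; exact: (measurable_rel (fun y z => y <> z)). Qed.

Lemma pr_differ (f g : X -> Y) :
  discrete_measurable f -> discrete_measurable g ->
  pr mu (differ f g) = 1 - pr mu (agree f g).
Proof. by move=> mf mg; rewrite -prC//; exact: measurable_agree. Qed.

(** A quantitative Borel-Cantelli argument: the limit is the eventual value, and it can differ from
    [f k x] only if the value jumps at some index [k + i]. These jumps have total measure at most
    the geometric tail [2^-k]. *)
Lemma fast_cauchy_limit (f : nat -> X -> Y) :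
  Y -> (forall k, discrete_measurable (f k)) ->
  (forall k, pr mu (differ (f k) (f k.+1)) <= (2 ^ k.+1)%:R^-1) ->
  exists2 g : X -> Y, discrete_measurable g &
    forall k, pr mu (differ g (f k)) <= (2 ^ k)%:R^-1.
Proof.
move=> y0 mf hf.
(* [Q y] collects the points at which the sequence is eventually equal to [y]. *)
pose Q y := \bigcup_K \bigcap_(k in [set k | (K <= k)%N]) (f k @^-1` [set y]).
have dQ x y z : Q y x -> Q z x -> y = z.
  move=> [K _ HK] [L _ HL].
  by rewrite -(HK (maxn K L) (leq_maxl _ _)) -(HL (maxn K L) (leq_maxr _ _)).
have mg : discrete_measurable (fun x => xget y0 [set y | Q y x]).
  apply: discrete_measurable_xget => // y.
  apply: bigcup_measurable => K _; apply: bigcap_measurable => [|k _].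
    by exists K => /=.
  exact: mf.
exists (fun x => xget y0 [set y | Q y x]) => // k.
apply: (@pr_geometric_cover _ _ _ _ _
  (fun i => differ (f (k + i)%N) (f (k + i).+1))) => [|||x /= ngx|i].
- by rewrite invr_ge0.
- exact: measurable_differ.
- by move=> i; exact: measurable_differ.
(* Without a jump from index [k] on, the sequence stays at [f k x], which is then its eventual
   value. *)
- apply: contrapT => nU; apply: ngx; apply: xget_subset1; last first.
    by move=> u v; exact: dQ.
  exists k => // j /= kj; rewrite -(subnKC kj).
  elim: (j - k)%N => [|i IHi]; first by rewrite addn0.
  rewrite addnS -[RHS]IHi; apply: contrapT => nE; apply: nU.
  by exists i => //=; move=> E; apply: nE; rewrite -E.
- apply: le_trans (hf _) _.
  by rewrite -invfM -natrM -expnD addnS.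
Qed.

(** At each point, [size s + 1] values in [s] must repeat, so the agreement sets of the pairs
    [i < j] cover [X]. Were they all of measure at most [e], the crude count of all ordered pairs
    would already give total mass below 1. *)
Lemma pigeonhole_agree (s : seq Y) (f : nat -> X -> Y) (e : R) :
  (forall y, y \in s) -> (forall k, discrete_measurable (f k)) ->
  0 <= e -> (((size s).+1 * (size s).+1)%:R * e < 1) ->
  exists i j, (i < j < (size s).+1)%N /\ e < pr mu (agree (f i) (f j)).
Proof.
move=> sT mf e0 e1; apply: contrapT => nE.
suff: 1 <= ((size s).+1 * (size s).+1)%:R * e by rewrite leNgt e1.
have -> : ((size s).+1 * (size s).+1)%N =
    size (allpairs pair (iota 0 (size s).+1) (iota 0 (size s).+1)).
  by rewrite size_allpairs !size_iota.
rewrite -[leLHS](prT mu).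
apply: le_trans (sum_le_size _ (P := fun p => (p.1 < p.2 < (size s).+1)%N)
  (f := fun p => pr mu (agree (f p.1) (f p.2))) e0 _); last first.
  by move=> [i j] /= ij; rewrite leNgt; apply/negP => h; apply: nE; exists i, j.
apply: pr_le_sum => //; first by move=> p; exact: measurable_agree.
move=> x _; pose t := [seq f i x | i <- iota 0 (size s).+1].
have : ~~ uniq t.
  apply/negP => ut; have /= := uniq_leq_size (s2 := s) ut (fun y _ => sT y).
  by rewrite size_map size_iota ltnn.
move=> /(uniqPn (f 0%N x))[i [j []]]; rewrite size_map size_iota => ij js.
have is_ : (i < (size s).+1)%N by exact: ltn_trans ij js.
rewrite !(nth_map 0%N) ?size_iota// !nth_iota// !add0n => E.
exists (i, j); split => //; last by rewrite /= ij.
by rewrite allpairs_f// mem_iota add0n.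
Qed.

End DiscreteMaps.

(** * Right actions and the defect of equivariance *)

Section Actions.
Context {R : realType} {G : groupType} {d1 d2 : measure_display}.
Context {X : measurableType d1} {Y : measurableType d2}.
Variables (mu : probability X R) (nu : probability Y R).
Variables (a : X -> G -> X) (b : Y -> G -> Y).
Hypothesis amu : mp_action mu a.
Hypothesis ra_b : right_action b.
Hypothesis finY : finite_set [set: Y].
Hypothesis mY : forall B : set Y, measurable B.

Definition defect (f : X -> Y) (g : G) : set X :=
  [set x | f (a x g) <> b (f x) g].

Lemma right_actionK (Z : Type) (c : Z -> G -> Z) z g :
  right_action c -> c (c z g) (monoid.inv g) = z.
Proof. by move=> [c1 cM]; rewrite cM /gmul mulgV c1. Qed.

Lemma right_actionVK (Z : Type) (c : Z -> G -> Z) z g :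
  right_action c -> c (c z (monoid.inv g)) g = z.
Proof. by move=> [c1 cM]; rewrite cM /gmul mulVg c1. Qed.

Lemma act_img_preimage (Z : Type) (c : Z -> G -> Z) (A : set Z) g :
  right_action c -> act_img c A g = [set z | A (c z (monoid.inv g))].
Proof.
move=> rc; apply/seteqP; split => [z [w Aw <-]|z Az] /=.
  by rewrite right_actionK.
by exists (c z (monoid.inv g)) => //; exact: right_actionVK.
Qed.

Lemma measurable_act (A : set X) g :
  measurable A -> measurable [set x | A (a x g)].
Proof.
by move=> mA; have [_ [ma _]] := amu; rewrite -[X in measurable X]setTI; exact: ma.
Qed.

Lemma pr_act (A : set X) g : measurable A -> pr mu [set x | A (a x g)] = pr mu A.
Proof. by move=> mA; have [_ [_ pa]] := amu; rewrite /pr pa. Qed.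

Lemma discrete_measurable_act (f : X -> Y) g :
  discrete_measurable f -> discrete_measurable (fun x => f (a x g)).
Proof. by move=> mf B; exact: measurable_act (mf B). Qed.

Lemma measurable_defect (f : X -> Y) g :
  discrete_measurable f -> measurable (defect f g).
Proof.
move=> mf; apply: (measurable_rel finY (fun y z => y <> b z g)) => //.
exact: discrete_measurable_act.
Qed.

(** * Agreement sets under strong ergodicity *)

Definition asymptotically_equivariant (f : nat -> X -> Y) :=
  forall g (e : R), 0 < e ->
    exists N, forall n, (N <= n)%N -> pr mu (defect (f n) g) < e.

(** If the two maps agree at [x] but not at the translate of [x] by the inverse of [g], then at
    least one of them fails to be equivariant at [x] for that inverse. Two defects thus bound the
    loss. *)
Lemma almost_invariant_agree (f h : nat -> X -> Y) :
  (forall n, discrete_measurable (f n)) ->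
  (forall n, discrete_measurable (h n)) ->
  asymptotically_equivariant f -> asymptotically_equivariant h ->
  almost_invariant mu a (fun n => agree (f n) (h n)).
Proof.
move=> mf mh ef eh; have ra_a := amu.1.
have mA n : measurable (agree (f n) (h n)) by exact: measurable_agree.
split=> // g; apply/cvgrPdist_lt => e e0.
have e2 : 0 < e / 2 by rewrite divr_gt0.
near=> n.
rewrite sub0r normrN ger0_norm; last exact: pr_ge0.
rewrite act_img_preimage//.
apply: (@le_lt_trans _ _ (pr mu (defect (f n) (monoid.inv g)) +
                          pr mu (defect (h n) (monoid.inv g)))).
  apply: pr_sub2.
  - by apply: measurableD => //; exact: measurable_act.
  - exact: measurable_defect.
  - exact: measurable_defect.
  - move=> x [/= fh nfh].
    have [E|] := pselect (f n (a x (monoid.inv g)) = b (f n x) (monoid.inv g));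
      last by left.
    by right=> E'; apply: nfh; rewrite /agree/= E E' fh.
rewrite (splitr e) ltrD//; near: n.
  by have [N HN] := ef (monoid.inv g) _ e2; exists N.
by have [N HN] := eh (monoid.inv g) _ e2; exists N.
Unshelve. all: by end_near. Qed.

(** Otherwise, pairs of arbitrarily late indices have agreement measure in [[e, 1 - e]]. Their
    agreement sets are almost invariant, yet [m (1 - m)] stays at least [e * e], so the sequence is
    not trivial. *)
Lemma agree_dichotomy (f : nat -> X -> Y) (e : R) :
  strongly_ergodic mu a ->
  (forall n, discrete_measurable (f n)) -> asymptotically_equivariant f ->
  0 < e ->
  exists N, forall n m, (N <= n)%N -> (N <= m)%N ->
    pr mu (agree (f n) (f m)) < e \/ 1 - e < pr mu (agree (f n) (f m)).
Proof.
move=> [_ se] mf ef e0; apply: contrapT => nN.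
have bad N : exists nm : nat * nat, [/\ (N <= nm.1)%N, (N <= nm.2)%N,
    e <= pr mu (agree (f nm.1) (f nm.2)) &
    pr mu (agree (f nm.1) (f nm.2)) <= 1 - e].
  apply: contrapT => nbad; apply: nN; exists N => n m Nn Nm.
  have [|en] := ltP (pr mu (agree (f n) (f m))) e; first by left.
  right; rewrite ltNge; apply/negP => ne; apply: nbad.
  by exists (n, m).
have {}bad N := cid (bad N); pose p N := sval (bad N).
have sub_ef (u : nat -> nat) : (forall N, (N <= u N)%N) ->
    asymptotically_equivariant (fun N => f (u N)).
  move=> uN g r r0; have [N HN] := ef g r r0.
  by exists N => n Nn; apply: HN; exact: leq_trans Nn (uN _).
have ai : almost_invariant mu a (fun N => agree (f (p N).1) (f (p N).2)).
  by apply: almost_invariant_agree => //; apply: sub_ef => N;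
    rewrite /p; case: (bad N) => q /= [].
have /cvgrPdist_lt/(_ (e * e)) := se _ ai.
have ee : 0 < e * e by rewrite mulr_gt0.
move=> /(_ ee) [N _ /(_ N (leqnn N))] /=.
rewrite /p; case: (bad N) => q /= [_ _ h1 h2]; apply/negP; rewrite -leNgt.
rewrite sub0r normrN ger0_norm; rewrite -/(pr mu _).
  by rewrite ler_pM ?(ltW e0)//; lra.
by rewrite mulr_ge0 ?pr_ge0//; lra.
Qed.

(** If agreement with each late map were eventually below [e], one could greedily pick [size s + 1]
    indices with pairwise agreement below [e], against the pigeonhole bound. *)
Lemma cluster_index (s : seq Y) (f : nat -> X -> Y) (e : R) (N0 : nat) :
  (forall y, y \in s) -> (forall n, discrete_measurable (f n)) ->
  0 <= e -> (((size s).+1 * (size s).+1)%:R * e < 1) ->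
  exists2 n0, (N0 <= n0)%N & forall M, exists2 n, (M <= n)%N &
    e <= pr mu (agree (f n0) (f n)).
Proof.
move=> sT mf e0 e1; apply: contrapT => nC.
(* The guard [N0 <= i] sits under the existential so that [choice] yields a threshold for every
   [i]. *)
have far i : exists M, (N0 <= i)%N -> forall n, (M <= n)%N ->
    pr mu (agree (f i) (f n)) < e.
  apply: contrapT => nM; apply: nC; exists i.
    by apply: contrapT => ni; apply: nM; exists 0%N => /ni.
  move=> M; apply: contrapT => nn; apply: nM; exists M => _ n Mn.
  by rewrite ltNge; apply/negP => en; apply: nn; exists n.
have {far} [M HM] := choice far.
have seqP k : exists u : nat -> nat, (forall i, (N0 <= u i)%N) /\
    forall i j, (i < j < k)%N -> pr mu (agree (f (u i)) (f (u j))) < e.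
  elim: k => [|k [u [u0 Hu]]].
    by exists (fun=> N0); split => // i j; rewrite ltn0 andbF.
  (* The new index passes the thresholds of all indices chosen before it. *)
  pose n := maxn N0 (\max_(i < k) M (u i)).
  exists (fun i => if i == k then n else u i); split.
    by move=> i; case: eqP => // _; exact: leq_maxl.
  move=> i j /andP[ij]; rewrite ltnS leq_eqVlt => /predU1P[jk|jk].
    subst j; rewrite eqxx (ltn_eqF ij); apply: HM => //.
    rewrite /n leq_max; apply/orP; right.
    exact: (leq_bigmax (Ordinal ij)).
  rewrite (ltn_eqF jk) (ltn_eqF (ltn_trans ij jk)).
  by apply: Hu; rewrite ij.
have [u [_ Hu]] := seqP (size s).+1.
have [i [j [ij]]] := pigeonhole_agree finY mu sT (fun k => mf (u k)) e0 e1.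
by rewrite ltNge (ltW (Hu _ _ ij)).
Qed.


(** Weak containment is applied to the partition of [Y] into points, with the position in [s] as the
    ordinal index. *)
Lemma weakly_contains_points (s : seq Y) (F : seq G) (e : R) :
  weakly_contains mu a nu b -> (forall y, y \in s) -> 0 < e ->
  exists2 B : Y -> set X, (forall y, measurable (B y)) &
    forall y z g, g \in F ->
      `|pr mu (act_img a (B y) g `&` B z) -
        pr nu (act_img b [set y] g `&` [set z])| < e.
Proof.
move=> wc sT e0; have ra_a := amu.1.
have si y : (index y s < size s)%N by rewrite index_mem.
pose o y := Ordinal (si y).
have [] := wc (size s) (fun i => [set y | o y = i]) F e => // B [mB HB].
exists (fun y => B (o y)) => // y z g gF.
have oE w : [set v | o v = o w] = [set w].
  apply/seteqP; split => [v [E]|v ->//] /=.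
  by rewrite -(nth_index w (sT v)) E nth_index.
have := HB (o y) (o z) g gF; rewrite !oE -lte_fin -abse_EFin EFinB !prK//.
apply: measurableI => //; rewrite act_img_preimage//; exact: measurable_act.
Qed.

(** One inequality serves two purposes: [C = setT] bounds the defect of [f], and a general [C]
    bounds the push-forward of [mu] from below. *)
Lemma almost_equivariant_map (s : seq Y) (F : seq G) (e : R) :
  weakly_contains mu a nu b -> uniq s -> (forall y, y \in s) -> 0 < e ->
  exists2 f : X -> Y, discrete_measurable f &
    forall g (C : set Y), g \in F ->
      pr nu C - e <= pr mu [set x | C (f x) /\ f (a x g) = b (f x) g].
Proof.
move=> wc us sT e0; have ra_a := amu.1.
pose k := size s.
(* Each of the [k] points of [Y] will lose at most [t + 2 k^2 t], in total [k (2 k^2 + 1) t]. The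
   extra successor keeps the denominator positive. *)
pose t : R := e / (k * (k * k).*2.+1).+1%:R.
have t0 : 0 < t by rewrite divr_gt0.
(* The identity controls the overlaps of the sets [B y], since distinct points of [Y] are disjoint.
   Inverses appear because [x] moves into [B (b z g)] under [g] exactly when [x] lies in the image
   of that set under the inverse. *)
have [B mB HB] := weakly_contains_points
  (monoid.one :: [seq monoid.inv g | g <- F]) wc sT t0.
(* Off the overlap D, the sets B y are the fibres of a map. *)
pose D := \bigcup_(p in [set p : Y * Y | p.1 <> p.2]) (B p.1 `&` B p.2).
have finYY : finite_set [set p : Y * Y | p.1 <> p.2].
  by apply: sub_finite_set (finite_setX finY finY).
have mD : measurable D.
  by apply: fin_bigcup_measurable => // p _; exact: measurableI.
have prD_le : pr mu D <= (k * k)%:R * t.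
  rewrite -(size_allpairs pair s s).
  apply: le_trans (sum_le_size _ (P := fun p => p.1 != p.2)
    (f := fun p => pr mu (B p.1 `&` B p.2)) (ltW t0) _).
    apply: pr_le_sum => // [p|x [[y z] /= /eqP yz [By Bz]]].
      exact: measurableI.
    by exists (y, z); split => //; rewrite allpairs_f.
  move=> [y z] /= yz; have := HB y z monoid.one (mem_head _ _).
  rewrite !act_img_preimage// invg1.
  have -> : [set x | B y (a x monoid.one)] = B y.
    by apply/seteqP; split=> x /=; rewrite ra_a.1.
  have -> : [set x | [set y] (b x monoid.one)] `&` [set z] = set0.
    apply/seteqP; split=> x //= []; rewrite ra_b.1 => -> yz'.
    by rewrite yz' eqxx in yz.
  rewrite [X in _ - X](_ : _ = 0) ?subr0 => [|]; last by rewrite /pr measure0.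
  by rewrite ger0_norm ?pr_ge0// => /ltW.
pose Q y := B y `\` \bigcup_(z in [set z | z <> y]) B z.
have mU y : measurable (\bigcup_(z in [set z | z <> y]) B z).
  by apply: fin_bigcup_measurable => //; exact: sub_finite_set finY.
have mQ y : measurable (Q y) by exact: measurableD.
have dQ x y z : Q y x -> Q z x -> y = z.
  move=> [By nBy] [Bz _]; apply: contrapT => yz; apply: nBy.
  by exists z => //= zy; apply: yz.
have BQ x y : B y x -> ~ D x -> Q y x.
  move=> By nD; split => // -[z /= zy Bz]; apply: nD.
  by exists (z, y).
have [y0 _] := cid (probability_setT_nonempty nu).
(* Points in no [Q y] go to [y0]; their measure needs no estimate, as only lower bounds for the good
   set are sought. *)
pose f x := xget y0 [set y | Q y x].
have mf : discrete_measurable f by exact: discrete_measurable_xget.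
have fQ x y : Q y x -> f x = y.
  by move=> Qyx; apply: xget_subset1 => // u v; exact: dQ.
exists f => // g C gF.
pose S z := Q z `&` [set x | Q (b z g) (a x g)].
have mS z : measurable (S z).
  by apply: measurableI => //; exact: measurable_act.
(* The loss is [t] from weak containment, plus [k^2 t] for [D] and the same for its translate. *)
have prS z : pr nu [set z] - t - (k * k)%:R * t *+ 2 <= pr mu (S z).
  pose T := act_img a (B (b z g)) (monoid.inv g) `&` B z.
  have mT : measurable T.
    rewrite /T act_img_preimage//; apply: measurableI => //.
    exact: measurable_act.
  have TS : pr mu T <= pr mu (S z) + pr mu D + pr mu [set x | D (a x g)].
    apply: pr_sub3 => //; first exact: measurable_act.
    rewrite /T act_img_preimage// invgK => x [/= Bg Bz].
    have [|nD] := pselect (D x); first by left; right.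
    have [|nDg] := pselect (D (a x g)); first by right.
    by left; left; split; exact: BQ.
  have := HB (b z g) z (monoid.inv g).
  rewrite inE map_f ?orbT// => /(_ isT); rewrite -/T.
  have -> : act_img b [set b z g] (monoid.inv g) `&` [set z] = [set z].
    rewrite act_img_preimage// invgK; apply/seteqP; split => [x []//|x -> /=].
    by [].
  rewrite ltr_distl => /andP[hT _].
  rewrite pr_act// in TS; lra.
have mW : measurable [set x | C (f x) /\ f (a x g) = b (f x) g].
  apply: (measurable_rel finY (fun y z => C y /\ z = b y g)) => //.
  exact: discrete_measurable_act.
have : \sum_(z <- s | `[< C z >]) pr mu (S z) <=
    pr mu [set x | C (f x) /\ f (a x g) = b (f x) g].
  apply: sum_le_pr => // [x y z [Qy _] [Qz _]|z /asboolP Cz x [Qz /= Qg]].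
    exact: dQ Qy Qz.
  by rewrite (fQ _ _ Qz) (fQ _ _ Qg).
apply: le_trans.
have prnuC : pr nu C <= \sum_(z <- s | `[< C z >]) pr nu [set z].
  by apply: pr_le_sum => // y Cy; exists y; split => //; exact/asboolP.
rewrite lerBlDr; apply: le_trans prnuC _.
have : \sum_(z <- s | `[< C z >]) (pr nu [set z] - pr mu (S z)) <=
    k%:R * (t + (k * k)%:R * t *+ 2).
  apply: sum_le_size => [|z _]; first by rewrite addr_ge0// ?mulrn_wge0//
    ?mulr_ge0// ltW.
  by have := prS z; lra.
rewrite sumrB lerBlDl => /le_trans; apply; rewrite lerD2l.
have eE : e = (k * (k * k).*2.+1).+1%:R * t by rewrite mulrC divfK.
rewrite eE -[in leRHS]natr1 [in leRHS]natrM -[in leRHS]natr1 -addnn [in leRHS]natrD.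
by lra.
Qed.

(** Maps agreeing with the anchor [f n0] on measure at least [e0] differ from it on at most
    [e0 <= 1/4], hence from each other on at most [1/2]. This excludes the low branch of the
    dichotomy at level [2^-(k+1)], and the high branch makes the subsequence fast Cauchy. *)
Lemma equivariant_subsequential_limit (s : seq Y) (f : nat -> X -> Y) :
  strongly_ergodic mu a -> Y -> (forall y, y \in s) ->
  (forall n, discrete_measurable (f n)) -> asymptotically_equivariant f ->
  exists2 h : X -> Y, discrete_measurable h &
    exists2 u : nat -> nat, (forall k, (k <= u k)%N) &
      forall k, pr mu (differ h (f (u k))) <= (2 ^ k)%:R^-1.
Proof.
move=> se y0 sT mf ef.
(* Using [size s + 2] makes the pigeonhole condition strict and gives [e0 <= 1/4] whatever the
   size. *)
pose e0 : R := ((size s).+2 * (size s).+2)%:R^-1.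
have e0_gt0 : 0 < e0 by rewrite invr_gt0 ltr0n.
have e0_le : e0 <= 4^-1.
  by rewrite lef_pV2 ?posrE ?ltr0n// ler_nat; apply: (@leq_mul 2 2).
have e0_lt : ((size s).+1 * (size s).+1)%:R * e0 < 1.
  by rewrite ltr_pdivrMr ?ltr0n// mul1r ltr_nat ltn_mul.
have [N0 HN0] := agree_dichotomy se mf ef e0_gt0.
have [n0 N0n0 Hn0] := cluster_index N0 sT mf (ltW e0_gt0) e0_lt.
have near0 n : (N0 <= n)%N -> e0 <= pr mu (agree (f n0) (f n)) ->
    pr mu (differ (f n0) (f n)) <= e0.
  move=> N0n; rewrite pr_differ//.
  by have [] := HN0 n0 n N0n0 N0n; lra.
have half_gt0 k : 0 < (2 ^ k)%:R^-1 :> R by rewrite invr_gt0 ltr0n expn_gt0.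
have [N HN] := choice (fun k => agree_dichotomy se mf ef (half_gt0 k.+1)).
(* The maximum over all [j <= k] ensures that [u k.+1] passes the threshold [N k] too. *)
pose L k := maxn (maxn N0 k) (\max_(j < k.+1) N j).
have /choice[u Hu] k : exists n, (L k <= n)%N /\ e0 <= pr mu (agree (f n0) (f n)).
  by have [n Ln en] := Hn0 (L k); exists n.
have u_ge k : [/\ (N0 <= u k)%N, (k <= u k)%N &
    forall j, (j <= k)%N -> (N j <= u k)%N].
  have [Lu _] := Hu k; split.
  - by apply: leq_trans Lu; rewrite /L !leq_max leqnn.
  - by apply: leq_trans Lu; rewrite /L !leq_max leqnn orbT.
  - move=> j jk; apply: leq_trans Lu; rewrite /L leq_max; apply/orP; right.
    exact: (leq_bigmax (Ordinal (jk : (j < k.+1)%N))).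
have [|k|h mh hu] := @fast_cauchy_limit _ _ _ _ finY mu (fun k => f (u k)) y0.
- by [].
- have [N0k kk Nk] := u_ge k; have [N0k1 _ Nk1] := u_ge k.+1.
  rewrite pr_differ//.
  have [|] := HN k _ _ (Nk k (leqnn k)) (Nk1 k (leqnSn k)); last by lra.
  have near_k := near0 _ N0k (Hu k).2; have near_k1 := near0 _ N0k1 (Hu k.+1).2.
  have : pr mu (differ (f (u k)) (f (u k.+1))) <=
      pr mu (differ (f n0) (f (u k))) + pr mu (differ (f n0) (f (u k.+1))).
    apply: pr_sub2 => [|||x]; try exact: measurable_differ.
    rewrite /differ/= => nE.
    have [E0|] := pselect (f n0 x = f (u k) x); last by left.
    by right => E; apply: nE; rewrite -E0.
  have : (2 ^ k.+1)%:R^-1 <= 2^-1 :> R.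
    by rewrite lef_pV2 ?posrE ?ltr0n ?expn_gt0// ler_nat expnS leq_pmulr// expn_gt0.
  by rewrite pr_differ//; lra.
- by exists h => //; exists u => // k; have [] := u_ge k.
Qed.

End Actions.

(** * Diagonal choice over the countable group and passage to the limit *)

Theorem theorem1 (R : realType) (G : groupType) (d1 d2 : measure_display)
  (X : measurableType d1) (Y : measurableType d2)
  (mu : probability X R) (nu : probability Y R)
  (a : X -> G -> X) (b : Y -> G -> Y) :
  countable [set: G] ->
  standard_borel R X ->
  mp_action mu a ->
  strongly_ergodic mu a ->
  finite_set [set: Y] ->
  (forall B : set Y, measurable B) ->
  (forall y : Y, (0 < nu [set y])%E) ->
  mp_action nu b ->
  weakly_contains mu a nu b ->
  is_factor mu a nu b.
Proof.
move=> cG _ amu se finY mY _ [ra_b _] wc.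
have [t tE] := (finite_seqP _).1 finY; pose s := undup t.
have us : uniq s by exact: undup_uniq.
have sT y : y \in s.
  by rewrite mem_undup; have : [set: Y] y by []; rewrite tE.
have [c c_inj] := countable_injP _ cG.
(* [r] enumerates [G] through the injection [c], with the identity as value off the range of [c]. *)
pose r k := xget (monoid.one : G) [set g | c g = k].
have rc g : r (c g) = g.
  apply: xget_subset1 => // g1 g2 /= h1 h2.
  by apply: c_inj; rewrite ?inE// h1.
have inv_gt0 n : 0 < n.+1%:R^-1 :> R by rewrite invr_gt0.
(* The map [f n] handles the first [n + 1] listed elements with error [1 / (n + 1)], so each fixed
   element is eventually covered. *)
have /choice[f Hf] n : exists f : X -> Y, discrete_measurable f /\
    forall i (C : set Y), (i <= n)%N ->
      pr nu C - n.+1%:R^-1 <=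
      pr mu [set x | C (f x) /\ f (a x (r i)) = b (f x) (r i)].
  have [f mf Hf] := almost_equivariant_map amu ra_b finY mY
    [seq r i | i <- iota 0 n.+1] wc us sT (inv_gt0 n).
  exists f; split => // i C ni; apply: Hf.
  by apply: map_f; rewrite mem_iota add0n ltnS.
have mf n : discrete_measurable (f n) by exact: (Hf n).1.
have ef : asymptotically_equivariant mu a b f.
  move=> g e e0; have [N] := ltr_add_invr e0; rewrite add0r => HN.
  exists (maxn N.+1 (c g)) => n; rewrite geq_max => /andP[Nn cn].
  have := (Hf n).2 (c g) setT cn; rewrite rc prT.
  have -> : [set x | setT (f n x) /\ f n (a x g) = b (f n x) g] =
      ~` defect a b (f n) g.
    by apply/seteqP; split => [x [_ E] //|x /contrapT].
  rewrite prC; last exact: (measurable_defect b amu).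
  rewrite lerD2l lerN2 => /le_lt_trans; apply; apply: le_lt_trans HN.
  by rewrite lef_pV2 ?posrE// ler_nat ltnS ltnW.
have [y0 _] := cid (probability_setT_nonempty nu).
have [h mh [u uk hu]] :=
  equivariant_subsequential_limit amu finY se y0 sT mf ef.
have small (e : R) : 0 < e -> exists K, forall k, (K <= k)%N ->
    (2 ^ k)%:R^-1 < e /\ (u k).+1%:R^-1 < e.
  move=> e0; have [K] := ltr_add_invr e0; rewrite add0r => HK.
  exists K.+1 => k Kk; split; apply: le_lt_trans HK;
    rewrite lef_pV2 ?posrE ?ltr0n ?expn_gt0// ler_nat.
    by rewrite (leq_trans Kk)// ltnW// ltn_expl.
  by rewrite ltnS (leq_trans _ (uk k))// ltnW.
exists h; split; first by move=> _ B _; rewrite setTI; exact: mh.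
split=> [g|].
  have mdef := measurable_defect b amu finY g mh.
  apply/(negligibleP mu mdef); apply: etrans (esym (prK mu mdef)) _; congr EFin.
  apply/eqP; rewrite eq_le pr_ge0 andbT; apply/ler_addgt0Pr => e e0; rewrite add0r.
  have e3 : 0 < e / 3 by rewrite divr_gt0.
  have [K HK] := small _ e3; have [M HM] := ef g _ e3.
  pose k := maxn K M; have [hk _] := HK k (leq_maxl _ _).
  have fk := HM (u k) (leq_trans (leq_maxr K M) (uk k)).
  have mdiff := measurable_differ finY mh (mf (u k)).
  (* Where [h] is not equivariant, it differs from [f (u k)] at [x] or at the translate of [x], or
     [f (u k)] has a defect. Invariance of [mu] gives both differences the same measure. *)
  have : pr mu (defect a b h g) <= pr mu (differ h (f (u k))) +
      pr mu [set x | differ h (f (u k)) (a x g)] + pr mu (defect a b (f (u k)) g).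
    apply: pr_sub3 => //; first exact: (measurable_act amu).
      exact: (measurable_defect b amu).
    move=> x; rewrite /defect /differ/= => nE.
    have [E1|] := pselect (h x = f (u k) x); last by left; left.
    have [E2|] := pselect (h (a x g) = f (u k) (a x g)); last by left; right.
    by right; rewrite -E1 -E2.
  by rewrite (pr_act amu)//; have := hu k; lra.
(* A lower bound for all [C] suffices: on complements it becomes the upper bound, as both measures
   have mass 1. *)
have le_h C : pr nu C <= pr mu (h @^-1` C).
  apply/ler_addgt0Pr => e e0; have e2 : 0 < e / 2 by rewrite divr_gt0.
  have [K HK] := small _ e2; have [hK uK] := HK K (leqnn K).
  have := (Hf (u K)).2 0%N C (leq0n _).
  have : pr mu [set x | C (f (u K) x) /\ f (u K) (a x (r 0)) = b (f (u K) x) (r 0)]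
      <= pr mu (h @^-1` C) + pr mu (differ h (f (u K))).
    apply: pr_sub2.
    - apply: (measurable_rel finY (fun y z => C y /\ z = b y (r 0))) => //.
      exact: (discrete_measurable_act amu).
    - exact: mh.
    - exact: measurable_differ.
    - move=> x /= [Cf _]; have [E|] := pselect (h x = f (u K) x); last by right.
      by left; rewrite /= E.
  by have := hu K; move: uK; set w := _.+1%:R^-1; lra.
move=> C mC; rewrite -(prK nu mC) -(prK mu (mh C)); congr EFin.
apply/eqP; rewrite eq_le le_h andbT.
have := le_h (~` C); rewrite preimage_setC !prC//; last exact: mh.
by rewrite lerD2l lerN2.
Qed.
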